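(* Let $r>0$, let $L=\{(r\cos\theta,r\sin\theta):0\le\theta\le2\pi\}\subset\mathbb{R}^2$ be the circle of radius $r$ with center $(0,0)$, and let $P$ be the uniform distribution on $L$. Then, with respect to the conditional set $\{(r,0)\}$ and the constraint $L$, the conditional constrained quantization dimension $D(P)$ exists and equals one, and the conditional constrained quantization coefficient for $P$ exists as a finite positive number and equals $\frac{\pi^2r^2}{3}$, i.e., $$\lim_{n\to\infty}n^2(V_n-V_\infty)=\frac{\pi^2r^2}{3}.$$
   Context: The uniform distribution $P$ on $L$ is normalized arc length: $dP=\frac{1}{2\pi}\,d\theta$ in the parametrization $\theta\mapsto(r\cos\theta,r\sin\theta)$. Let $d$ be the Euclidean distance on $\mathbb{R}^2$. With constraint $S=L$ and conditional set $\beta=\{(r,0)\}$ (so $\mathrm{card}(\beta)=1$), the $n$th conditional constrained quantization error, $n\ge1$, is $$V_n=V_n(P)=\inf_\alpha\Big\{\int\min_{a\in\alpha\cup\beta}d(x,a)^2\,dP(x) : \alpha\subseteq L,\ 0\le\mathrm{card}(\alpha)\le n-1\Big\},$$ and $V_\infty=V_\infty(P)=\lim_{n\to\infty}V_n(P)$. The conditional constrained quantization dimension is $$D(P)=\lim_{n\to\infty}\frac{2\log n}{-\log(V_n(P)-V_\infty(P))}$$ when the limit exists (i.e. when the corresponding liminf and limsup agree). For $\kappa>0$, the $\kappa$-dimensional conditional constrained quantization coefficient is $\lim_{n\to\infty}n^{2/\kappa}(V_n(P)-V_\infty(P))$ if it exists; here $\kappa=1$. *)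

(* Defs.v *)
From HB Require Import structures.
From mathcomp Require Import all_boot all_order all_algebra finmap.
From mathcomp Require Import all_classical all_reals all_analysis.
From mathcomp Require Import measurable_realfun.

Set Implicit Arguments.
Unset Strict Implicit.
Unset Printing Implicit Defensive.

Import Order.TTheory GRing.Theory Num.Theory.
Import numFieldNormedType.Exports.

Local Open Scope classical_set_scope.
Local Open Scope ring_scope.

Section conditional_constrained_quantization.
Context (R : realType).
Implicit Types (P : {measure set (R * R) -> \bar R}) (S : set (R * R)).
Implicit Types (alpha beta : {fset R * R}).

(* The library norm on [R * R] is the sup norm, hence this definition. *)
Definition eucl_dist (x y : R * R) : R :=
  Num.sqrt ((x.1 - y.1) ^+ 2 + (x.2 - y.2) ^+ 2).

(* The minimum is taken in [\bar R], where the empty minimum is [+oo]. *)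
Definition distortion P alpha : \bar R :=
  (\int[P]_x \big[Order.min/+oo]_(a <- alpha) (eucl_dist x a ^+ 2)%:E)%E.

(* Meaningful for [n >= #|` beta|]; the subtraction is truncated. *)
Definition quant_error P S beta (n : nat) : \bar R :=
  ereal_inf [set distortion P (alpha `|` beta)%fset | alpha in
    [set alpha : {fset R * R} |
      [set` alpha] `<=` S /\ (#|` alpha| <= n - #|` beta|)%N]].

Definition quant_error_infty P S beta : \bar R :=
  lim (quant_error P S beta n @[n --> \oo]).

Definition quant_gap P S beta (n : nat) : R :=
  fine (quant_error P S beta n - quant_error_infty P S beta)%E.

(* The dimension exists and equals [D]. *)
Definition quant_dimension P S beta (D : R) : Prop :=
  2 * ln n%:R / - ln (quant_gap P S beta n) @[n --> \oo] --> D.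

(* The [kappa]-dimensional coefficient exists and equals [c]. *)
Definition quant_coefficient P S beta (kappa c : R) : Prop :=
  n%:R `^ (2 / kappa) * quant_gap P S beta n @[n --> \oo] --> c.

End conditional_constrained_quantization.

Section uniform_on_circle.
Context (R : realType).

(* [measurableTypeR R] is [R] with the sigma-algebra on which [uniform_prob]
   is defined. *)
Definition circle_param (r : R) (theta : measurableTypeR R) : R * R :=
  (r * cos theta, r * sin theta).

Lemma measurable_circle_param (r : R) :
  measurable_fun [set: measurableTypeR R] (circle_param r).
Proof.
have : measurable_fun [set: R] (circle_param r); last by [].
apply: measurable_fun_pair; apply: measurable_funM => //;
  apply: continuous_measurable_fun.
- exact: continuous_cos.
- exact: continuous_sin.
Qed.

HB.instance Definition _ (r : R) :=
  isMeasurableFun.Build _ _ (measurableTypeR R) (R * R)%type (circle_param r)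
    (measurable_circle_param r).

Definition circle (r : R) : set (R * R) := circle_param r @` `[0, 2 * pi].

Lemma twopi_gt0 : 0 < 2 * pi :> R.
Proof. by rewrite mulr_gt0 ?pi_gt0. Qed.

Definition uniform_circle (r : R) : probability (R * R)%type R :=
  distribution (uniform_prob twopi_gt0)
    (circle_param r : {mfun measurableTypeR R >-> (R * R)%type}).

End uniform_on_circle.

(* Main.v *)
Require Import Defs.
From mathcomp Require Import all_boot all_order all_algebra finmap.
From mathcomp Require Import all_classical all_reals all_analysis.
From mathcomp Require Import measurable_realfun.
From mathcomp Require Import ring lra zify.

Import Order.TTheory GRing.Theory Num.Theory.
Import numFieldNormedType.Exports.

Local Open Scope classical_set_scope.
Local Open Scope ring_scope.

(* Put d = pi / n. The n equally spaced points at the angles 2 k d give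
   V_n <= r^2 d^2 / 3, because the squared distance between the points of
   angles s and t is 2 r^2 (1 - cos (s - t)) <= r^2 (s - t)^2. Conversely, with
   K = r^2 cos^2 (d / 2), every angle s in [d, 2 pi - d] and every finite set of
   angles t satisfy
     K d^2 <= min_t |x_s - x_t|^2 + sum_t K max (0, d^2 - (s - t)^2),
   so that the minimum is bounded below by a sum of bumps whose integrals do not
   depend on the positions of the points. With at most n points, integrating in
   s gives V_n >= K d^2 (1 / 3 - 1 / n); restricting s to [d, 2 pi - d] avoids
   the wrap-around of angles and only costs the term 1 / n. Hence V_n tends to 0
   and n^2 V_n tends to pi^2 r^2 / 3; the dimension follows by taking
   logarithms. *)

(** * Bounds on [1 - cos u], hence on squared chord lengths *)

Section trigonometry.
Context {R : realType}.
Implicit Types x u d : R.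

(** The mean value theorem for [sin] on [0, x]. The factor [cos c] serves both directions: its
    square is at most 1, and it is bounded below since [c <= x]. *)
Lemma sin_mul_cos x : 0 <= x -> exists2 c, 0 <= c <= x & sin x = x * cos c.
Proof.
move=> x0.
have [c] : exists2 c, c \in `[0, x] & sin x - sin 0 = cos c * (x - 0).
  apply: MVT_segment => //.
  by apply: continuous_subspaceT => y; exact: continuous_sin.
by rewrite in_itv/= sin0 !subr0 mulrC => cx ->; exists c.
Qed.

Lemma onemcos_half u : 1 - cos u = 2 * sin (u / 2) ^+ 2.
Proof.
have {1}-> : u = (u / 2) *+ 2 by rewrite -mulr_natr; field.
rewrite cos_mulr2n sin2cos2; ring.
Qed.

Lemma onemcos_le u : 2 * (1 - cos u) <= u ^+ 2.
Proof.
rewrite -(cos_norm u) onemcos_half -(real_normK (num_real u)).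
have [|c _ ->] := @sin_mul_cos (`|u| / 2); first by rewrite divr_ge0.
have -> : 2 * (2 * (`|u| / 2 * cos c) ^+ 2) = `|u| ^+ 2 * cos c ^+ 2 by field.
by rewrite ler_piMr ?sqr_ge0// cos2sin2 lerBlDr lerDl sqr_ge0.
Qed.

Lemma ler_cos_pi x y : 0 <= x -> x <= y -> y <= pi -> cos y <= cos x.
Proof.
move=> x0 xy ypi; move: xy; rewrite le_eqVlt => /predU1P[->//|xy].
rewrite ltW// ltr_cos// in_itv/= ?x0 ?ypi ?andbT.
- by rewrite (le_trans (ltW xy)).
- by rewrite (le_trans x0 (ltW xy)).
Qed.

(** The intermediate angle [c] lies in [0, |u| / 2], so [cos c >= cos (d / 2) >= 0] because [cos]
    decreases on [0, pi]. *)
Lemma onemcos_ge d u : d <= pi -> `|u| <= d ->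
  cos (d / 2) ^+ 2 * u ^+ 2 <= 2 * (1 - cos u).
Proof.
move=> dpi ud.
rewrite -(cos_norm u) onemcos_half -(real_normK (num_real u)).
have [|c /andP[c0 cu] ->] := @sin_mul_cos (`|u| / 2); first by rewrite divr_ge0.
have -> : 2 * (2 * (`|u| / 2 * cos c) ^+ 2) = cos c ^+ 2 * `|u| ^+ 2 by field.
have := @pi_gt0 R => pi0.
have := normr_ge0 u => u0.
rewrite ler_wpM2r ?sqr_ge0// ler_pXn2r// ?nnegrE.
- by apply: ler_cos_pi => //; lra.
- by apply: cos_ge0_pihalf; apply/andP; split; lra.
- by apply: cos_ge0_pihalf; apply/andP; split; lra.
Qed.

(** The chord grows with the angle up to pi. Beyond pi, [|u|] is reflected to [2 * pi - |u|], which
    has the same cosine and lies in [d, pi]. *)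
Lemma onemcos_far d u : 0 <= d <= pi -> d <= `|u| <= 2 * pi - d ->
  cos (d / 2) ^+ 2 * d ^+ 2 <= 2 * (1 - cos u).
Proof.
move=> /andP[d0 dpi] /andP[du ud].
apply: (@le_trans _ _ (2 * (1 - cos d))).
  by apply: onemcos_ge => //; rewrite ger0_norm.
rewrite ler_pM2l// lerB// -(cos_norm u).
have [upi|/ltW upi] := leP `|u| pi; first exact: ler_cos_pi.
rewrite -(cosN `|u|) -(cosD2pi (- `|u|)).
apply: ler_cos_pi => //; rewrite -mulr_natl; lra.
Qed.

Lemma eucl_dist_circle (r s t : R) :
  eucl_dist (circle_param r s) (circle_param r t) ^+ 2 =
  r ^+ 2 * (2 * (1 - cos (s - t))).
Proof.
rewrite /eucl_dist sqr_sqrtr ?addr_ge0 ?sqr_ge0//= cosB.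
have := cos2Dsin2 s; have := cos2Dsin2 t; nra.
Qed.

End trigonometry.

(** * Integrals of quadratics and bumps; finite minima in the extended reals *)

Section integration.
Context {R : realType}.
Implicit Types d u v : R.
Notation mu := (@lebesgue_measure R).

Lemma continuous_quadratic (a b c : R) :
  continuous (fun x : R => c + b * (x - a) ^+ 2).
Proof.
by move=> x; apply: differentiable_continuous; apply/derivable1_diffP.
Qed.

Lemma integral_quadratic (a b c : R) u v : u < v ->
  (\int[mu]_(x in `[u, v]) (c + b * (x - a) ^+ 2)%:E =
  (c * (v - u) + b * ((v - a) ^+ 3 - (u - a) ^+ 3) / 3)%:E)%E.
Proof.
move=> uv; pose F (x : R) := c * x + b * ((x - a) ^+ 3 / 3).
have dF (x : R) : is_derive x 1 F (c + b * (x - a) ^+ 2).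
  rewrite /F; apply: is_derive_eq.
  by rewrite /GRing.scale/=; field.
have cF (x : R) : {for x, continuous F}.
  by apply: differentiable_continuous; apply/derivable1_diffP; case: (dF x).
rewrite (@continuous_FTC2 _ _ F)//.
- by rewrite -EFinB; congr EFin; rewrite /F; field.
- exact/continuous_subspaceT/continuous_quadratic.
- split=> [x _||]; first by case: (dF x).
  + exact/cvg_at_right_filter/cF.
  + exact/cvg_at_left_filter/cF.
- by move=> x _; rewrite derive1E; case: (dF x).
Qed.

(** Reduces the integral over a full turn to a uniform bound on short arcs. *)
Lemma le_integral_steps (f : R -> \bar R) d (C : R) m : 0 < d ->
  measurable_fun setT f -> (forall x, 0 <= f x)%E ->
  (forall j, (j < m)%N ->
    (\int[mu]_(x in `[(j%:R * d)%R, (j.+1%:R * d)%R]) f x <= C%:E)%E) ->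
  (\int[mu]_(x in `[0%R, (m%:R * d)%R]) f x <= (m%:R * C)%:E)%E.
Proof.
move=> d0 mf f0; elim: m => [|m IH] H.
  by rewrite !mul0r set_itv1 integral_set1.
(* The last step is taken half-open so that the two pieces are disjoint; its integral agrees with
   that over the closed step. *)
have <- : `[0, m%:R * d] `|` `]m%:R * d, m.+1%:R * d] =
  `[0, m.+1%:R * d]%classic.
  rewrite -itv_bndbnd_setU// bnd_simp.
    by rewrite mulr_ge0// ltW.
  by rewrite ler_wpM2r ?ler_nat// ltW.
rewrite ge0_integral_setU//=.
- rewrite -[in X in (_ <= X)%E]natr1 mulrDl mul1r EFinD leeD//.
    by apply: IH => j jm; apply: H; rewrite ltnS ltnW.
  rewrite integral_itv_obnd_cbnd ?H//.
  exact: measurable_funTS.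
- exact: measurable_funTS.
- apply/disj_setPRL => x /=; rewrite !in_itv/= => /andP[+ _] /andP[_].
  by move=> /lt_le_trans/[apply]; rewrite ltxx.
Qed.

Lemma bigmin_ge0 (T : Type) (s : seq T) (f : T -> \bar R) :
  (forall a, 0 <= f a)%E -> (0 <= \big[Order.min/+oo]_(a <- s) f a)%E.
Proof.
move=> f0; elim: s => [|a s IH]; first by rewrite big_nil leey.
by rewrite big_cons le_min f0.
Qed.

Lemma bigmin_le_mem (T : eqType) (s : seq T) (f : T -> \bar R) a :
  a \in s -> (\big[Order.min/+oo]_(a <- s) f a <= f a)%E.
Proof.
elim: s => // b s IH; rewrite inE big_cons ge_min => /predU1P[->|/IH ->].
  by rewrite lexx.
by rewrite orbT.
Qed.

(** If the minimum is attained at [a], then [g a] is one of the terms of the nonnegative sum, and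
    the bound at [a] suffices. For empty [s] the minimum is [+oo]. *)
Lemma bigmin_add_sum (T : eqType) (s : seq T) (f g : T -> \bar R) (c : \bar R) :
  (forall a, 0 <= g a)%E -> {in s, forall a, c <= f a + g a}%E ->
  (c <= \big[Order.min/+oo]_(a <- s) f a + \sum_(a <- s) g a)%E.
Proof.
move=> g0; elim: s => [|a s IH] H; first by rewrite !big_nil adde0 leey.
rewrite !big_cons; set S := (\sum_(_ <- s) _)%E.
have S0 : (0 <= S)%E by exact: sume_ge0.
have {}IH : (c <= \big[Order.min/+oo]_(j <- s) f j + S)%E.
  by apply: IH => b bs; rewrite H// in_cons bs orbT.
rewrite minElt; case: ifP => _.
  by apply: (le_trans (H a (mem_head _ _))); rewrite leeD// leeDl.
by apply: (le_trans IH); rewrite leeD// leeDr.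
Qed.

Lemma measurable_bigmin disp (T : measurableType disp) (I : Type) (s : seq I)
    (f : I -> T -> \bar R) : (forall i, measurable_fun setT (f i)) ->
  measurable_fun setT (fun x => \big[Order.min/+oo]_(i <- s) f i x)%E.
Proof.
move=> mf; elim: s => [|i s IH].
  by under eq_fun do rewrite big_nil; exact: measurable_cst.
by under eq_fun do rewrite big_cons; exact: measurable_mine.
Qed.

(** The bump is a parabola on [a - d, a + d] and vanishes elsewhere. *)
Lemma integral_bump (a : R) d : 0 < d ->
  (\int[mu]_x (Num.max 0 (d ^+ 2 - (x - a) ^+ 2))%:E = (4 / 3 * d ^+ 3)%:E)%E.
Proof.
move=> d0.
transitivity (\int[mu]_(x in `[(a - d)%R, (a + d)%R])
    (d ^+ 2 + - 1 * (x - a) ^+ 2)%:E)%E; last first.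
  rewrite integral_quadratic; last by lra.
  by congr EFin; field.
rewrite [RHS]integral_mkcond; apply: eq_integral => x _; rewrite patchE.
have E : ((x - a) ^+ 2 <= d ^+ 2) = (x \in `[a - d, a + d]).
  rewrite -ler_sqrt ?sqr_ge0 ?exprn_gt0// !sqrtr_sqr (gtr0_norm d0).
  by rewrite in_itv/= ler_distl.
case: ifPn => [/set_mem/=|/negP xad].
  by rewrite -E => ?; rewrite mulN1r max_r// subr_ge0.
rewrite max_l// subr_le0 ltW// ltNge E; apply/negP => ?; apply: xad.
exact: mem_set.
Qed.

Lemma measurable_bump (a : R) d :
  measurable_fun setT (fun x : R => (Num.max 0 (d ^+ 2 - (x - a) ^+ 2))%:E).
Proof.
apply/measurable_EFinP; apply: measurable_maxr => //.
apply: continuous_measurable_fun => x.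
have -> : (fun x => d ^+ 2 - (x - a) ^+ 2) =
  (fun x => d ^+ 2 + - 1 * (x - a) ^+ 2).
  by apply/funext => y; rewrite mulN1r.
exact: continuous_quadratic.
Qed.

End integration.

(** * Lower and upper bounds on the distortion of finite sets *)

Section circle_distortion.
Context {R : realType}.
Implicit Types r : R.
Notation mu := (@lebesgue_measure R).

Lemma measurable_eucl_dist_sqr (a : R * R) :
  measurable_fun setT (fun x : R * R => (eucl_dist x a ^+ 2)%:E).
Proof.
apply/measurable_EFinP.
have -> : (fun x : R * R => eucl_dist x a ^+ 2) =
    (fun x => (x.1 - a.1) ^+ 2 + (x.2 - a.2) ^+ 2).
  by apply/funext => x; rewrite sqr_sqrtr// addr_ge0 ?sqr_ge0.
by apply: measurable_funD; apply: measurable_funX; apply: measurable_funB.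
Qed.

Lemma measurable_circle_min r (s : {fset R * R}) :
  measurable_fun setT (fun x : R =>
    \big[Order.min/+oo]_(a <- s) (eucl_dist (circle_param r x) a ^+ 2)%:E)%E.
Proof.
apply: measurable_bigmin => a.
apply: (measurableT_comp (measurable_eucl_dist_sqr a)).
exact: measurable_circle_param.
Qed.

Lemma circle_min_ge0 r (s : {fset R * R}) (x : R) :
  (0 <= \big[Order.min/+oo]_(a <- s)
          (eucl_dist (circle_param r x) a ^+ 2)%:E)%E.
Proof. by apply: bigmin_ge0 => a; rewrite lee_fin sqr_ge0. Qed.

Lemma distortion_uniform_circle r (s : {fset R * R}) :
  distortion (uniform_circle r) s =
  (((2 * pi)^-1)%:E * \int[mu]_(x in `[0%R, (2 * pi)%R])
    \big[Order.min/+oo]_(a <- s) (eucl_dist (circle_param r x) a ^+ 2)%:E)%E.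
Proof.
rewrite /distortion ge0_integral_distribution.
- rewrite integral_uniform ?subr0//.
  + exact: measurable_circle_min.
  + by move=> x; exact: circle_min_ge0.
- by apply: measurable_bigmin => a; exact: measurable_eucl_dist_sqr.
- by move=> x; apply: bigmin_ge0 => a; rewrite lee_fin sqr_ge0.
Qed.

(** If [|s - t| <= d], the squared distance is at least [K (s - t)^2], with K = r^2 cos^2 (d / 2),
    and the bump supplies the rest of [K d^2]. Otherwise the distance alone suffices: the ranges of
    [s] and [t] force [|s - t| <= 2 * pi - d]. *)
Lemma circle_dist_add_bump r d s t : 0 < d <= pi ->
  0 <= t <= 2 * pi -> d <= s <= 2 * pi - d ->
  r ^+ 2 * cos (d / 2) ^+ 2 * d ^+ 2 <=
  eucl_dist (circle_param r s) (circle_param r t) ^+ 2 +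
  r ^+ 2 * cos (d / 2) ^+ 2 * Num.max 0 (d ^+ 2 - (s - t) ^+ 2).
Proof.
move=> /andP[d0 dpi] /andP[t0 tpi] /andP[ds spi].
rewrite eucl_dist_circle -mulrA -[X in _ + X]mulrA -mulrDr ler_wpM2l ?sqr_ge0//.
have [std|/ltW std] := leP `|s - t| d.
  apply: le_trans; last by apply: lerD (lexx _); exact: onemcos_ge std.
  by rewrite -mulrDr ler_wpM2l ?sqr_ge0// -lerBlDl le_max lexx orbT.
apply: (@le_trans _ _ (2 * (1 - cos (s - t)))).
  apply: onemcos_far; first by rewrite ltW.
  by rewrite std ler_norml; apply/andP; split; lra.
by rewrite lerDl mulr_ge0 ?sqr_ge0// le_max lexx.
Qed.

Lemma distortion_circle_ge r (s : {fset R * R}) n d :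
  (1 < n)%N -> n%:R * d = pi ->
  [set` s] `<=` circle r -> (#|` s| <= n)%N ->
  ((r ^+ 2 * cos (d / 2) ^+ 2 * d ^+ 2 * (1 / 3 - n%:R^-1))%:E <=
   distortion (uniform_circle r) s)%E.
Proof.
move=> n1 nd sC sn.
have n0 : 0 < n%:R :> R by rewrite ltr0n ltnW.
have pi0 := @pi_gt0 R.
have d0 : 0 < d by rewrite -(pmulr_rgt0 _ n0) nd.
have dpi2 : 2 * d <= pi by rewrite -nd ler_wpM2r ?ler_nat// ltW.
set K := r ^+ 2 * cos (d / 2) ^+ 2.
have K0 : 0 <= K by rewrite mulr_ge0 ?sqr_ge0.
(* [t p] is a chosen angle of [p]; it is meaningful for points of the circle, hence for every [p] in
   [s]. *)
pose t p := get [set x : R | x \in `[0, 2 * pi] /\ circle_param r x = p].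
have tP p : p \in s -> 0 <= t p <= 2 * pi /\ circle_param r (t p) = p.
  move=> ps; have [x xI xp] : circle r p by exact: sC.
  have := @getPex _ [set x : R | x \in `[0, 2 * pi] /\ circle_param r x = p].
  by rewrite -/(t p) /= in_itv/=; apply; exists x.
pose I := `[d, 2 * pi - d]%classic.
have mI : measurable I by exact: measurable_itv.
pose D (x : R) := (\big[Order.min/+oo]_(a <- s)
  (eucl_dist (circle_param r x) a ^+ 2)%:E)%E.
pose psi p x := (K%:E * (Num.max 0 (d ^+ 2 - (x - t p) ^+ 2))%:E)%E.
have psi0 p x : (0 <= psi p x)%E.
  by rewrite /psi -EFinM lee_fin mulr_ge0// le_max lexx.
have mpsi p : measurable_fun setT (psi p).
  by apply: measurable_funeM; exact: measurable_bump.
have intpsi p : (\int[mu]_(x in I) psi p x <= (K * (4 / 3 * d ^+ 3))%:E)%E.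
  (* Integrating over the whole line removes the dependence on [t p]. *)
  apply: (@le_trans _ _ (\int[mu]_x psi p x)%E).
    by apply: ge0_subset_integral => //; exact: mpsi.
  rewrite /psi ge0_integralZl_EFin//.
  - by rewrite integral_bump.
  - by move=> x _; rewrite lee_fin le_max lexx.
  - exact: measurable_bump.
have mD : measurable_fun I D.
  exact: measurable_funTS (measurable_circle_min r s).
have mpsiI p : measurable_fun I (psi p) by exact: measurable_funTS (mpsi p).
have msum : measurable_fun I (fun x => \sum_(p <- s) psi p x)%E.
  exact: emeasurable_sum.
have D0 x : (0 <= D x)%E by exact: circle_min_ge0.
have : (\int[mu]_(x in I) (cst (K * d ^+ 2)%:E) x <=
    \int[mu]_(x in I) (D x + \sum_(p <- s) psi p x))%E.
  apply: ge0_le_integral => //.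
  - by move=> x _; rewrite lee_fin mulr_ge0// sqr_ge0.
  - exact: emeasurable_funD.
  move=> x; rewrite /I /= in_itv/= => xI.
  apply: bigmin_add_sum => // p ps.
  have [tp <-] := tP p ps.
  rewrite /psi -EFinM -EFinD lee_fin.
  have [_ ->] := tP p ps.
  rewrite -[in X in eucl_dist _ X](tP p ps).2.
  by apply: circle_dist_add_bump => //; rewrite d0/=; lra.
rewrite integral_cst//= lebesgue_measure_itv/= lte_fin ifT; last by lra.
rewrite ge0_integralD//; last by move=> x _; exact: sume_ge0.
rewrite ge0_integral_sum//.
move=> H.
(* The domain of [D] grows from [I] to a full turn, and at most [n] bumps are counted. *)
have {}H : ((K * d ^+ 2 * (2 * pi - d - d))%:E <=
    \int[mu]_(x in `[0%R, (2 * pi)%R]) D x +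
      (n%:R * (K * (4 / 3 * d ^+ 3)))%:E)%E.
  rewrite EFinM EFinB; apply: (le_trans H); apply: leeD.
    apply: ge0_subset_integral => //.
    - exact: measurable_funTS (measurable_circle_min r s).
    - by move=> x; rewrite /I/= !in_itv/= => /andP[? ?]; apply/andP; split; lra.
  apply: (@le_trans _ _ (\sum_(p <- s) (K * (4 / 3 * d ^+ 3))%:E)%E).
    by apply: lee_sum => p _.
  rewrite sumEFin lee_fin big_const_seq count_predT iter_addr_0.
  rewrite -[leLHS]mulr_natl ler_wpM2r ?ler_nat//.
  by rewrite mulr_ge0// mulr_ge0 ?exprn_ge0 ?ltW.
rewrite distortion_uniform_circle -/D muleC -lee_pdivrMr ?invr_gt0 ?mulr_gt0//.
rewrite -leeBlDr// -EFinB in H.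
apply: le_trans H.
(* With pi = n d, both sides equal K d^3 (2 n / 3 - 2). *)
rewrite -EFinM lee_fin invrK -nd le_eqVlt; apply/orP; left; apply/eqP.
by field; rewrite gt_eqF.
Qed.

(** The indices [k = 0] and [k = n] both give the conditional point (r, 0), so only the [n - 1]
    indices strictly between them need points of [alpha]. *)
Lemma circle_equispaced r n d : (0 < n)%N -> n%:R * d = pi ->
  exists alpha : {fset R * R}, [/\ [set` alpha] `<=` circle r,
    (#|` alpha| <= n - 1)%N &
    forall k, (k <= n)%N ->
      circle_param r (k.*2%:R * d) \in (alpha `|` [fset (r, 0)])%fset].
Proof.
move=> n0 nd.
have d0 : 0 <= d.
  by rewrite -(pmulr_rge0 _ (_ : 0 < n%:R)) ?ltr0n// nd pi_ge0.
pose s := [seq circle_param r (k.*2%:R * d) | k <- iota 1 (n - 1)].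
have n2d : n.*2%:R * d = 2 * pi by rewrite -nd -muln2 natrM; ring.
exists [fset x in s]%fset; split.
- move=> x /=; rewrite inE => /mapP[k]; rewrite mem_iota => /andP[_ kn] ->.
  exists (k.*2%:R * d) => //=; rewrite in_itv/= mulr_ge0//=.
  by rewrite -n2d ler_wpM2r// ler_nat leq_double; lia.
- by rewrite card_fseq (leq_trans (size_undup _))// size_map size_iota.
move=> k kn; rewrite !inE.
have [->|k0] := eqVneq k 0%N.
  by rewrite /circle_param mul0r cos0 sin0 mulr1 mulr0 eqxx orbT.
have [->|kn'] := eqVneq k n.
  rewrite n2d mulr_natl /circle_param cos2pi sin2pi.
  by rewrite mulr1 mulr0 eqxx orbT.
apply/orP; left; apply/mapP; exists k => //; rewrite mem_iota; lia.
Qed.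

(** The circle is cut into 2 n arcs of angle [d], each having one of the given points as an
    endpoint. Using that endpoint alone, every arc contributes at most r^2 d^3 / 3. *)
Lemma distortion_circle_le r n d (s : {fset R * R}) :
  (0 < n)%N -> n%:R * d = pi ->
  (forall k, (k <= n)%N -> circle_param r (k.*2%:R * d) \in s) ->
  (distortion (uniform_circle r) s <= (r ^+ 2 * d ^+ 2 / 3)%:E)%E.
Proof.
move=> n0 nd sP.
have pi0 := @pi_gt0 R.
have n0' : 0 < n%:R :> R by rewrite ltr0n.
have d0 : 0 < d by rewrite -(pmulr_rgt0 _ n0') nd.
have n2d : n.*2%:R * d = 2 * pi by rewrite -nd -muln2 natrM; ring.
rewrite distortion_uniform_circle muleC -lee_pdivlMr ?invr_gt0 ?mulr_gt0//.
rewrite -n2d; apply: (@le_trans _ _ (n.*2%:R * (r ^+ 2 * d ^+ 3 / 3))%:E).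
  apply: le_integral_steps => //.
  - exact: measurable_circle_min.
  - by move=> x; exact: circle_min_ge0.
  move=> j jn; set k := uphalf j.
  have kn : (k <= n)%N by rewrite /k; lia.
  apply: (@le_trans _ _ (\int[mu]_(x in `[(j%:R * d)%R, (j.+1%:R * d)%R])
      (0 + r ^+ 2 * (x - k.*2%:R * d) ^+ 2)%:E)%E).
    apply: ge0_le_integral => //.
    - by move=> x _; exact: circle_min_ge0.
    - exact: measurable_funTS (measurable_circle_min r s).
    - apply/measurable_EFinP/measurable_funTS.
      by apply: continuous_measurable_fun => x; exact: continuous_quadratic.
    - move=> x _; apply: le_trans; first exact: bigmin_le_mem (sP k kn).
      rewrite lee_fin eucl_dist_circle add0r ler_wpM2l ?sqr_ge0//.
      exact: onemcos_le.
  rewrite integral_quadratic; last by rewrite ltr_pM2r// ltr_nat.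
  rewrite lee_fin le_eqVlt; apply/orP; left; apply/eqP.
  (* Rounding [j] up to an even number gives the left end of the arc for even [j] and the right end
     for odd [j]. *)
  have : k.*2%:R = j%:R :> R \/ k.*2%:R = j.+1%:R :> R.
    have [jo|je] := boolP (odd j); [right|left]; congr (_%:R); rewrite /k; lia.
  by case=> ->; rewrite -natr1; field.
rewrite -EFinM lee_fin invrK n2d -(mulrC (2 * pi)) -n2d.
rewrite le_eqVlt; apply/orP; left; apply/eqP.
by field.
Qed.

End circle_distortion.

(** * Asymptotics of the quantization error and of its logarithm *)

Section quantization.
Context {R : realType}.
Implicit Types r : R.

Let V r n := quant_error (uniform_circle r) (circle r) [fset (r, 0)]%fset n.

Lemma quant_error_circle_ge r n : (1 < n)%N ->
  ((r ^+ 2 * cos (pi / n%:R / 2) ^+ 2 * (pi / n%:R) ^+ 2 *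
    (1 / 3 - n%:R^-1))%:E <= V r n)%E.
Proof.
move=> n1; apply: le_ereal_inf_tmp => _ [alpha [aC an]] <-.
apply: distortion_circle_ge => //.
- by rewrite mulrC divfK// pnatr_eq0 -lt0n ltnW.
- move=> x /=; rewrite !inE => /orP[/aC//|/eqP ->].
  exists 0; last by rewrite /circle_param cos0 sin0 mulr1 mulr0.
  by rewrite /= in_itv/= lexx ltW// twopi_gt0.
- have [+ _] := leq_card_fsetU alpha [fset (r, 0)]%fset.
  by move: an; rewrite !cardfs1; lia.
Qed.

Lemma quant_error_circle_le r n : (0 < n)%N ->
  (V r n <= (r ^+ 2 * (pi / n%:R) ^+ 2 / 3)%:E)%E.
Proof.
move=> n0.
have nd : n%:R * (pi / n%:R) = pi :> R.
  by rewrite mulrC divfK// pnatr_eq0 -lt0n.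
have [alpha [aC an aP]] := circle_equispaced r n _ n0 nd.
apply: (le_trans _ (distortion_circle_le r n _ _ n0 nd aP)).
by apply: ereal_inf_lbound; exists alpha => //; split=> //; rewrite cardfs1.
Qed.

Lemma quant_error_circle_ge0 r n : (0 <= V r n)%E.
Proof.
apply: le_ereal_inf_tmp => _ [alpha _] <-.
apply: integral_ge0 => x _; apply: bigmin_ge0 => a.
by rewrite lee_fin sqr_ge0.
Qed.

Lemma cvg_natV : (n%:R^-1 : R) @[n --> \oo] --> (0 : R).
Proof.
apply/gtr0_cvgV0; last exact: cvgr_idn.
by near=> n; rewrite ltr0n; near: n; exact: nbhs_infty_gt.
Unshelve. all: by end_near. Qed.

Lemma cvg_quant_error_circle r : V r n @[n --> \oo] --> 0%E.
Proof.
apply: (@squeeze_cvge _ _ _ _ (cst 0%E) _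
  (fun n => (r ^+ 2 * (pi / n%:R) ^+ 2 / 3)%:E)).
- near=> n; rewrite quant_error_circle_ge0 quant_error_circle_le//.
  by near: n; exact: nbhs_infty_gt.
- exact: cvg_cst.
apply: cvg_EFin; first by near=> n.
rewrite (_ : 0 = r ^+ 2 * (pi * 0) ^+ 2 / 3); last by ring.
apply: cvgMl; apply: cvgMr; rewrite expr2.
by apply: cvgM; apply: cvgMr; exact: cvg_natV.
Unshelve. all: by end_near. Qed.

Lemma quant_gap_circle r n :
  quant_gap (uniform_circle r) (circle r) [fset (r, 0)]%fset n = fine (V r n).
Proof.
rewrite /quant_gap /quant_error_infty.
have /cvg_lim -> := cvg_quant_error_circle r; last by [].
by rewrite sube0.
Qed.

Lemma cvg_sqr_quant_gap_circle r :
  n%:R ^+ 2 * quant_gap (uniform_circle r) (circle r) [fset (r, 0)]%fset n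
    @[n --> \oo] --> pi ^+ 2 * r ^+ 2 / 3.
Proof.
apply: (@squeeze_cvgr _ _ _ _ (fun n => pi ^+ 2 * r ^+ 2 *
  (cos (pi / 2 * n%:R^-1) * cos (pi / 2 * n%:R^-1)) * (1 / 3 - n%:R^-1))
  (cst (pi ^+ 2 * r ^+ 2 / 3))).
- near=> n.
  have n1 : (1 < n)%N by near: n; exact: nbhs_infty_gt.
  have n0 : n%:R != 0 :> R by rewrite pnatr_eq0; lia.
  have := quant_error_circle_le r n (ltnW n1).
  have := quant_error_circle_ge r n n1.
  rewrite quant_gap_circle.
  (* The two finite bounds exclude infinite values, so [fine] loses nothing. *)
  case: (V r n) => [v| |]//; rewrite !lee_fin/= => lo up.
  have n2 : 0 < n%:R ^+ 2 :> R by rewrite exprn_even_gt0.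
  apply/andP; split.
    apply: (le_trans _ (ler_wpM2l (ltW n2) lo)).
    rewrite (_ : pi / 2 * n%:R^-1 = pi / n%:R / 2); last by rewrite mulrAC.
    by rewrite le_eqVlt; apply/orP; left; apply/eqP; field.
  apply: (le_trans (ler_wpM2l (ltW n2) up)).
  by rewrite le_eqVlt; apply/orP; left; apply/eqP; field.
- rewrite (_ : pi ^+ 2 * r ^+ 2 / 3 =
    pi ^+ 2 * r ^+ 2 * (cos (pi / 2 * 0) * cos (pi / 2 * 0)) * (1 / 3 - 0)).
    have cvgcos : cos (pi / 2 * n%:R^-1) @[n --> \oo] --> cos (pi / 2 * 0 : R).
      apply: continuous_cvg; first exact: continuous_cos.
      by apply: cvgMr; exact: cvg_natV.
    apply: cvgM; first by apply: cvgMr; exact: cvgM.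
    by apply: cvgB; [exact: cvg_cst | exact: cvg_natV].
  by rewrite mulr0 cos0; ring.
- exact: cvg_cst.
Unshelve. all: by end_near. Qed.

Lemma cvg_lnn : ln n%:R @[n --> \oo] --> (+oo : set_system R).
Proof.
apply/cvgryPge => A; near=> n.
have An : expR A <= n%:R by near: n; exact: (cvgry_ge cvgr_idn).
by rewrite -ler_expR lnK// posrE (lt_le_trans (expR_gt0 A)).
Unshelve. all: by end_near. Qed.

(** Since - ln g = 2 ln n - ln (n^2 g), the ratio is the inverse of 1 - ln (n^2 g) / (2 ln n), where
    ln (n^2 g) converges and ln n diverges. *)
Lemma cvg_ln_ratio (c : R) (g : nat -> R) : 0 < c ->
  n%:R ^+ 2 * g n @[n --> \oo] --> c ->
  2 * ln n%:R / - ln (g n) @[n --> \oo] --> (1 : R).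
Proof.
move=> c0 gc.
have lnc : ln (n%:R ^+ 2 * g n) @[n --> \oo] --> ln c.
  by apply: continuous_cvg => //; exact: continuous_ln.
have lnV : (ln n%:R)^-1 @[n --> \oo] --> (0 : R).
  apply/gtr0_cvgV0; last exact: cvg_lnn.
  near=> n; apply: ln_gt0; rewrite ltr1n.
  by near: n; exact: nbhs_infty_gt.
have H : (1 - ln (n%:R ^+ 2 * g n) * ((ln n%:R)^-1 / 2))^-1 @[n --> \oo]
    --> (1 - ln c * (0 / 2))^-1.
  apply: cvgV; first by rewrite mul0r mulr0 subr0 oner_eq0.
  apply: cvgB; first exact: cvg_cst.
  by apply: cvgM => //; apply: cvgMl.
rewrite mul0r mulr0 subr0 invr1 in H.
apply: cvg_trans H; apply: near_eq_cvg; near=> n.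
have n1 : (1 < n)%N by near: n; exact: nbhs_infty_gt.
have n2 : 0 < n%:R ^+ 2 :> R by rewrite exprn_gt0// ltr0n ltnW.
have ln0 : 0 < ln n%:R :> R by rewrite ln_gt0// ltr1n.
(* Positivity of [g n] holds only eventually, from the positive limit [c]; it is what allows the
   logarithm of the product to be split. *)
have gn : 0 < g n.
  rewrite -(pmulr_rgt0 _ n2); near: n.
  exact: (cvgr_gt _ gc).
rewrite lnM ?posrE// lnXn ?ltr0n ?(ltnW n1)// -[ln _ *+ _]mulr_natl.
rewrite (_ : 1 - _ = - ln (g n) / (2 * ln n%:R)); last first.
  by field; rewrite gt_eqF.
by rewrite invf_div.
Unshelve. all: by end_near. Qed.

End quantization.

Theorem theorem4p1p7 (R : realType) (r : R) (r_gt0 : 0 < r) :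
  let P := uniform_circle r in
  let L := circle r in
  let beta := [fset (r, 0)]%fset in
  [/\ quant_dimension P L beta 1,
      quant_coefficient P L beta 1 (pi ^+ 2 * r ^+ 2 / 3),
      0 < pi ^+ 2 * r ^+ 2 / 3 &
      n%:R ^+ 2 * quant_gap P L beta n @[n --> \oo] --> pi ^+ 2 * r ^+ 2 / 3].
Proof.
move=> P L beta.
have c0 : 0 < pi ^+ 2 * r ^+ 2 / 3.
  by rewrite divr_gt0// mulr_gt0 ?exprn_gt0 ?pi_gt0.
have gapc := cvg_sqr_quant_gap_circle r.
split=> //; first exact: cvg_ln_ratio c0 gapc.
(* For kappa = 1 the real exponent 2 / kappa is the natural number 2. *)
rewrite /quant_coefficient divr1.
by under eq_fun do rewrite powR_mulrn//.
Qed.
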